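(* Let $a<b$, let $h:[a,b]\to[0,\infty)$ be a concave function that is not identically zero, and let $\alpha,\beta>0$. Let $\mathrm{g}_\alpha(h)=\frac{\int_a^b t\,h(t)^\alpha\,dt}{\int_a^b h(t)^\alpha\,dt}$. If $\beta\leq\alpha$ then \[\frac{\int_{\mathrm{g}_\alpha(h)}^b h(t)^\beta\,dt}{\int_a^b h(t)^\beta\,dt}\geq\left(\frac{\beta+1}{\alpha+2}\right)^{\beta+1},\] whereas if $\alpha\leq\beta$ then \[\frac{\int_{\mathrm{g}_\alpha(h)}^b h(t)^\beta\,dt}{\int_a^b h(t)^\beta\,dt}\geq\left(\frac{\alpha+1}{\alpha+2}\right)^{\beta+1}.\] *)

(* Defs.v *)
From Stdlib Require Import Reals Lra.
From Coquelicot Require Import Coquelicot.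
Open Scope R_scope.

(* Real power x^y for x >= 0 and y > 0, with the convention 0^y = 0
   (Stdlib's Rpower 0 y = exp (y * ln 0) = 1, which is wrong here). *)
Definition rpow (x y : R) : R :=
  if Req_EM_T x 0 then 0 else Rpower x y.

Definition concave_on (a b : R) (h : R -> R) : Prop :=
  forall x y l, a <= x <= b -> a <= y <= b -> 0 <= l <= 1 ->
    l * h x + (1 - l) * h y <= h (l * x + (1 - l) * y).

Definition g_alpha (alpha a b : R) (h : R -> R) : R :=
  RInt (fun t => t * rpow (h t) alpha) a b / RInt (fun t => rpow (h t) alpha) a b.

(* Main.v *)
(* Write [F x] for the integral of [h^beta] over [[x,b]] and [G = F^(1/(beta+1))].  By a
   one-dimensional Brunn-Minkowski argument [h/G] is nondecreasing, and since
   [(beta+1) G' = - (h/G)^beta], the function [G] is concave.  Jensen's inequality bounds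
   [G] at the centroid below by the [h^alpha]-average of [G].  In the variable [u = G/G(a)] the
   measure [h^alpha dt] has density [phi(u) u^A (1-u)^B du] with [phi] nondecreasing in [u],
   where [(A, B) = (alpha, 0)] if [alpha <= beta] (as [h/G] is monotone) and
   [(A, B) = (beta, alpha - beta)] if [beta <= alpha] (as [h/(G(a)-G)] is monotone: [h] is
   concave, [G(a)-G] convex and zero at [a]).  By Chebyshev's inequality the average of [u]
   is at least the mean [(A+1)/(A+B+2)] of the beta density.  Since [h] may jump at
   the endpoints, it is first replaced by the continuous extension of its restriction to the
   open interval. *)
Require Import Defs.
From Stdlib Require Import Reals Lra Classical ssreflect.
From Coquelicot Require Import Coquelicot.
Open Scope R_scope.

(** * Real powers of a nonnegative base *)

(* Extended by 0 to the negatives, unlike [rpow], so as to be continuous on the whole line. *)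
Definition ppow (x y : R) : R :=
  match Rle_dec x 0 with left _ => 0 | right _ => Rpower x y end.

Lemma Rpower_pos (x y : R) : 0 < Rpower x y.
Proof. apply exp_pos. Qed.

Lemma ppow_pos_eq (x y : R) : 0 < x -> ppow x y = Rpower x y.
Proof. intros hx; unfold ppow; destruct (Rle_dec x 0); [lra | easy]. Qed.

Lemma ppow_npos_eq (x y : R) : x <= 0 -> ppow x y = 0.
Proof. intros hx; unfold ppow; destruct (Rle_dec x 0); [easy | lra]. Qed.

Lemma ppow_ge0 (x y : R) : 0 <= ppow x y.
Proof.
  unfold ppow; destruct (Rle_dec x 0); [lra | left; apply Rpower_pos].
Qed.

Lemma rpow_ppow (x y : R) : 0 <= x -> rpow x y = ppow x y.
Proof.
  intros hx; unfold rpow; destruct (Req_EM_T x 0) as [-> | hx0].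
  - rewrite ppow_npos_eq //; lra.
  - rewrite ppow_pos_eq //; lra.
Qed.

Lemma is_derive_Rpower (x y : R) :
  0 < x -> is_derive (fun u => Rpower u y) x (y * Rpower x (y - 1)).
Proof. intros hx; apply is_derive_Reals; now apply derivable_pt_lim_power. Qed.

Lemma locally_gt (x y : R) : x < y -> locally y (fun u => x < u).
Proof. intros h; now apply (open_gt x y). Qed.

Lemma locally_lt (x y : R) : y < x -> locally y (fun u => u < x).
Proof. intros h; now apply (open_lt x y). Qed.

Lemma locally_between (a b x : R) : a < x < b -> locally x (fun u => a < u < b).
Proof.
  intros h; apply filter_and; [now apply locally_gt | now apply locally_lt].
Qed.

Lemma is_derive_ppow (x y : R) :
  0 < x -> is_derive (fun u => ppow u y) x (y * Rpower x (y - 1)).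
Proof.
  intros hx; eapply is_derive_ext_loc; [ | now apply is_derive_Rpower].
  apply: filter_imp (locally_gt 0 x hx) => u hu.
  now rewrite ppow_pos_eq.
Qed.

Lemma continuous_ppow (x y : R) : 0 < y -> continuous (fun u => ppow u y) x.
Proof.
  intros hy; destruct (total_order_T x 0) as [[hx | hx] | hx].
  - apply: (continuous_ext_loc _ (fun _ => 0)); [ | apply continuous_const].
    apply: filter_imp (locally_lt 0 x hx) => u hu.
    rewrite ppow_npos_eq //; lra.
  - subst x; apply filterlim_locally => eps.
    (* The radius [eps^(1/y)] is chosen so that [0 < u < eps^(1/y)] gives [u^y < eps]. *)
    exists (mkposreal _ (Rpower_pos eps (1 / y))) => u hu.
    change (Rabs (u - 0) < Rpower eps (1 / y)) in hu.
    change (Rabs (ppow u y - ppow 0 y) < eps).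
    rewrite (ppow_npos_eq 0) ?Rminus_0_r; [ | lra].
    rewrite Rabs_pos_eq; [ | apply ppow_ge0].
    rewrite Rminus_0_r in hu; apply Rabs_def2 in hu.
    destruct (Rle_dec u 0) as [h | h].
    + rewrite ppow_npos_eq //; apply cond_pos.
    + rewrite ppow_pos_eq; [ | lra].
      apply Rlt_le_trans with (Rpower (Rpower eps (1 / y)) y).
      * apply Rlt_Rpower_l; lra.
      * rewrite Rpower_mult; replace (1 / y * y) with 1 by (field; lra).
        rewrite Rpower_1; [lra | apply cond_pos].
  - apply: ex_derive_continuous; eexists; now apply is_derive_ppow.
Qed.

Lemma continuous_ppow_comp (f : R -> R) (x y : R) :
  0 < y -> continuous f x -> continuous (fun u => ppow (f u) y) x.
Proof.
  intros hy hf; apply (continuous_comp f (fun u => ppow u y)); [easy | ].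
  now apply continuous_ppow.
Qed.

Lemma is_derive_ppow_comp (f : R -> R) (x df y : R) :
  0 < f x -> is_derive f x df ->
  is_derive (fun u => ppow (f u) y) x (y * Rpower (f x) (y - 1) * df).
Proof.
  intros hx hf; rewrite Rmult_comm.
  apply: (is_derive_comp (fun u => ppow u y) f) => //; now apply is_derive_ppow.
Qed.

(** * Consequences of the mean value theorem *)

(** Differentiability is asked for in the open interval only, because the root [G] of the tail
    integral may fail to be differentiable at [b]. *)
Lemma mean_value (f df : R -> R) (a b : R) :
  a < b ->
  (forall x, a < x < b -> is_derive f x (df x)) ->
  (forall x, continuous f x) ->
  exists c, a < c < b /\ f b - f a = df c * (b - a).
Proof.
  intros hab hd hc.
  pose (pr := fun c hc' => exist _ (df c) (proj1 (is_derive_Reals f c (df c)) (hd c hc'))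
          : derivable_pt f c).
  destruct (MVT f id a b pr (fun c _ => derivable_pt_id c) hab) as (c & P & E).
  - intros; apply continuity_pt_filterlim, hc.
  - intros; apply derivable_continuous_pt, derivable_pt_id.
  - exists c; split; [easy | ].
    rewrite derive_pt_id in E; unfold id in E; simpl in E; lra.
Qed.

Lemma is_derive_RInt_continuous (f : R -> R) (a x : R) :
  (forall x, continuous f x) -> is_derive (fun u => RInt f a u) x (f x).
Proof.
  intros hf; apply: (is_derive_RInt f _ a x); [ | apply hf].
  apply filter_forall => u; apply: RInt_correct.
  now apply: ex_RInt_continuous.
Qed.

Lemma is_derive_RInt_continuous' (f : R -> R) (b x : R) :
  (forall x, continuous f x) -> is_derive (fun u => RInt f u b) x (- f x).
Proof.
  intros hf; apply: (is_derive_RInt' f _ x b); [ | apply hf].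
  apply filter_forall => u; apply: RInt_correct.
  now apply: ex_RInt_continuous.
Qed.

(* The derivative of [P] is only required in the open interval: no integrability of [dP]. *)
Lemma RInt_ge_increment (f P dP : R -> R) (a b : R) :
  a < b ->
  (forall x, continuous f x) -> (forall x, continuous P x) ->
  (forall x, a < x < b -> is_derive P x (dP x)) ->
  (forall x, a < x < b -> dP x <= f x) ->
  P b - P a <= RInt f a b.
Proof.
  intros hab hf hP hd hle.
  destruct (mean_value (fun x => RInt f a x - P x) (fun x => f x - dP x) a b hab)
    as (c & hc & E).
  - intros x hx; apply: is_derive_minus; [ | now apply hd].
    now apply is_derive_RInt_continuous.
  - intros x; apply: continuous_minus; [ | apply hP].
    apply: ex_derive_continuous; eexists; now apply is_derive_RInt_continuous.
  - rewrite RInt_point in E; change (zero : R) with 0 in E.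
    specialize (hle c hc).
    assert (0 <= (f c - dP c) * (b - a)) by (apply Rmult_le_pos; lra); lra.
Qed.

Lemma antitone_of_derive (G k : R -> R) (a b : R) :
  (forall x, continuous G x) ->
  (forall x, a < x < b -> is_derive G x (- k x)) ->
  (forall x, a < x < b -> 0 < k x) ->
  forall s t, a <= s -> s < t -> t <= b -> G t < G s.
Proof.
  intros hG hd hk s t hs hst ht.
  destruct (mean_value G (fun x => - k x) s t hst) as (c & hc & E); [ | easy | ].
  - intros x hx; apply hd; lra.
  - assert (0 < k c * (t - s)) by (apply Rmult_lt_0_compat; [apply hk | ]; lra); lra.
Qed.

(** As [- k] is nonincreasing, [G] is concave and lies below its tangents: the slope at the mean
    value point between [g] and [t] is compared with the slope at [g]. *)
Lemma concave_tangent (G k : R -> R) (a b g t : R) :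
  (forall x, continuous G x) ->
  (forall x, a < x < b -> is_derive G x (- k x)) ->
  (forall s t, a < s -> s < t -> t < b -> k s <= k t) ->
  a < g < b -> a < t < b -> G t <= G g - k g * (t - g).
Proof.
  intros hG hd hk hg ht; destruct (total_order_T g t) as [[h | h] | h].
  - destruct (mean_value G (fun x => - k x) g t h) as (c & hc & E); [ | easy | ].
    + intros x hx; apply hd; lra.
    + assert (k g <= k c) by (apply hk; lra).
      assert (0 <= (k c - k g) * (t - g)) by (apply Rmult_le_pos; lra); lra.
  - subst; lra.
  - destruct (mean_value G (fun x => - k x) t g h) as (c & hc & E); [ | easy | ].
    + intros x hx; apply hd; lra.
    + assert (k c <= k g) by (apply hk; lra).
      assert (0 <= (k g - k c) * (g - t)) by (apply Rmult_le_pos; lra); lra.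
Qed.

(** * Centroids of weights *)

(** Through this identity, an affine function has as its [w]-average its value at the centroid of
    [w], the equality case of Jensen's inequality. *)
Lemma RInt_affine_mul (w : R -> R) (a b p q : R) :
  (forall x, continuous w x) ->
  RInt (fun t => (p + q * t) * w t) a b
    = p * RInt w a b + q * RInt (fun t => t * w t) a b.
Proof.
  intros hw.
  assert (htw : forall x, continuous (fun t => t * w t) x).
  { intros x; apply: continuous_mult; [apply continuous_id | apply hw]. }
  transitivity (RInt (fun x => plus (scal p (w x)) (scal q (x * w x))) a b).
  { apply RInt_ext => x _; rewrite /plus /scal /= /mult /=; ring. }
  rewrite RInt_plus; [ | apply: ex_RInt_continuous => x _; apply: continuous_scal_r ..].
  - rewrite (RInt_scal w) ?(RInt_scal (fun x => x * w x)) //;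
      now apply: ex_RInt_continuous.
  - apply hw.
  - apply htw.
Qed.

(** The integrals of [(t - a) w] and [(b - t) w] are both positive. *)
Lemma centroid_between (w : R -> R) (a b : R) :
  a < b -> (forall x, continuous w x) -> (forall x, a < x < b -> 0 < w x) ->
  a < RInt (fun t => t * w t) a b / RInt w a b < b.
Proof.
  intros hab hw hpos.
  assert (hW : 0 < RInt w a b) by (apply RInt_gt_0; auto).
  assert (hc : forall p q x, continuous (fun t => (p + q * t) * w t) x).
  { intros p q x; apply: continuous_mult; [ | apply hw].
    apply: continuous_plus; [apply continuous_const | ].
    apply: continuous_mult; [apply continuous_const | apply continuous_id]. }
  assert (h1 : 0 < RInt (fun t => (- a + 1 * t) * w t) a b).
  { apply RInt_gt_0; auto.
    intros x hx; apply Rmult_lt_0_compat; [lra | now apply hpos]. }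
  assert (h2 : 0 < RInt (fun t => (b + (-1) * t) * w t) a b).
  { apply RInt_gt_0; auto.
    intros x hx; apply Rmult_lt_0_compat; [lra | now apply hpos]. }
  rewrite RInt_affine_mul // in h1; rewrite RInt_affine_mul // in h2.
  split; [apply Rlt_div_r | apply Rlt_div_l]; lra.
Qed.

(* With [c = (A+1)/(A+B+2)], the function [G^(A+1) (G a - G)^(B+1)] vanishes at both ends and
   its derivative is a positive multiple of [(G - c G a) G^A (G a - G)^B k].  As [phi]
   decreases and [G - c G a] passes from positive to negative at [t0],
   [(G - c G a) w] dominates [phi t0] times that expression; concavity bounds
   [G] by its tangent at the centroid, whose [w]-average is [G] at the centroid. *)
Lemma centroid_value_ge (G k w phi : R -> R) (a b A B : R) :
  a < b -> 0 <= A -> 0 <= B ->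
  (forall x, continuous G x) ->
  (forall x, a < x < b -> is_derive G x (- k x)) ->
  (forall x, a < x < b -> 0 < k x) ->
  (forall s t, a < s -> s < t -> t < b -> k s <= k t) ->
  G b = 0 ->
  (forall x, continuous w x) ->
  (forall x, a < x < b -> 0 < phi x) ->
  (forall s t, a < s -> s < t -> t < b -> phi t <= phi s) ->
  (forall x, a < x < b ->
     w x = phi x * (Rpower (G x) A * Rpower (G a - G x) B * k x)) ->
  (A + 1) / (A + B + 2) * G a <= G (RInt (fun t => t * w t) a b / RInt w a b).
Proof.
  intros hab hA hB hG hd hk hmono hGb hw hphi hanti hE.
  assert (hdec := antitone_of_derive G k a b hG hd hk).
  assert (hGa : 0 < G a) by (rewrite -hGb; apply hdec; lra).
  assert (hpos : forall x, a < x < b -> 0 < w x).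
  { intros x hx; rewrite hE //.
    repeat apply Rmult_lt_0_compat; try apply Rpower_pos; auto. }
  assert (hg := centroid_between w a b hab hw hpos).
  assert (hW : 0 < RInt w a b) by (apply RInt_gt_0; auto).
  set (g := RInt (fun t => t * w t) a b / RInt w a b) in *.
  assert (hgE : g * RInt w a b = RInt (fun t => t * w t) a b)
    by (unfold g; field; lra).
  set (N := A + B + 2); set (c := (A + 1) / N).
  assert (hN : 0 < N) by (unfold N; lra).
  assert (hc : 0 < c < 1).
  { unfold c; split; [apply Rdiv_lt_0_compat; lra | ].
    apply Rlt_div_l; unfold N; lra. }
  assert (hcG : 0 < c * G a < G a).
  { split; [apply Rmult_lt_0_compat; lra | ].
    assert (0 < (1 - c) * G a) by (apply Rmult_lt_0_compat; lra); lra. }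
  destruct (IVT_gen G a b (c * G a)) as (t0 & ht0 & Et0).
  { intros x; apply continuity_pt_filterlim, hG. }
  { rewrite hGb Rmin_right ?Rmax_left; lra. }
  rewrite Rmin_left ?Rmax_right in ht0; [ | lra ..].
  assert (ht0' : a < t0 < b).
  { split.
    - destruct (Req_dec t0 a) as [-> | ]; lra.
    - destruct (Req_dec t0 b) as [-> | ]; lra. }
  assert (hI : 0 <= RInt (fun t => (G g - c * G a + k g * g + - k g * t) * w t) a b).
  (* The factor [phi t0 / N] makes the derivative of [P] exactly
     [phi t0 (G - c G a) G^A (G a - G)^B k]. Using [ppow] keeps [P] continuous on the whole line. *)
  { set (P := fun t => phi t0 / N * (ppow (G t) (A + 1) * ppow (G a - G t) (B + 1))).
    replace 0 with (P b - P a).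
    2:{ unfold P; rewrite hGb (ppow_npos_eq 0) ?(ppow_npos_eq (G a - G a)); lra. }
    apply (RInt_ge_increment _ P (fun t =>
      phi t0 * (G t - c * G a) * (Rpower (G t) A * Rpower (G a - G t) B * k t))) => //.
    - intros x; apply: continuous_mult; [ | apply hw].
      apply: continuous_plus; [apply continuous_const | ].
      apply: continuous_mult; [apply continuous_const | apply continuous_id].
    - intros x; apply: continuous_mult; [apply continuous_const | ].
      apply: continuous_mult; apply: continuous_ppow_comp; try lra.
      + apply hG.
      + apply: continuous_minus; [apply continuous_const | apply hG].
    - intros x hx; unfold P.
      assert (h1 : 0 < G x) by (rewrite -hGb; apply hdec; lra).
      assert (h2 : 0 < G a - G x) by (assert (G x < G a) by (apply hdec; lra); lra).
      assert (d1 := is_derive_ppow_comp G x (- k x) (A + 1) h1 (hd x hx)).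
      assert (d2 : is_derive (fun t => ppow (G a - G t) (B + 1)) x
                     ((B + 1) * Rpower (G a - G x) (B + 1 - 1) * (0 - - k x))).
      { apply: is_derive_ppow_comp => //.
        apply: is_derive_minus; [apply: is_derive_const | now apply hd]. }
      assert (d3 := is_derive_scal _ x (phi t0 / N) _
                      (is_derive_mult _ _ x _ _ d1 d2 Rmult_comm)).
      evar_last; [exact d3 | ].
      rewrite /plus /scal /= /mult /=.
      rewrite !ppow_pos_eq //.
      replace (A + 1 - 1) with A by ring; replace (B + 1 - 1) with B by ring.
      rewrite !Rpower_plus !Rpower_1 //.
      unfold c; field_simplify_eq; [ unfold N; ring | lra].
    - intros x hx.
      assert (htan := concave_tangent G k a b g x hG hd hmono hg hx).
      apply Rle_trans with ((G x - c * G a) * w x).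
      + rewrite hE //; set (m := Rpower (G x) A * Rpower (G a - G x) B * k x).
        assert (hm : 0 < m).
        { repeat apply Rmult_lt_0_compat; try apply Rpower_pos; auto. }
        assert (0 <= ((G x - c * G a) * (phi x - phi t0)) * m); [ | lra].
        apply Rmult_le_pos; [ | lra].
        (* The pointwise form of Chebyshev's inequality: [G x - G t0] and [phi x - phi t0] are both
           nonnegative left of [t0] and both nonpositive right of it. *)
        rewrite -Et0; destruct (total_order_T x t0) as [[h | ->] | h].
        * apply Rmult_le_pos.
          -- assert (G t0 < G x) by (apply hdec; lra); lra.
          -- assert (phi t0 <= phi x) by (apply hanti; lra); lra.
        * lra.
        * replace ((G x - G t0) * (phi x - phi t0))
            with ((G t0 - G x) * (phi t0 - phi x)) by ring.
          apply Rmult_le_pos.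
          -- assert (G x < G t0) by (apply hdec; lra); lra.
          -- assert (phi x <= phi t0) by (apply hanti; lra); lra.
      + apply Rmult_le_compat_r; [left; now apply hpos | lra]. }
  rewrite RInt_affine_mul // -hgE in hI.
  apply Rnot_lt_le => hlt.
  assert (0 < (c * G a - G g) * RInt w a b) by (apply Rmult_lt_0_compat; lra).
  lra.
Qed.

(** * Concave functions and their tail integrals *)

(** Concavity with weight [(t - x) / (t - s)] and denominators cleared, so that comparisons of
    slopes become linear in the values of [h]. *)
Lemma concave_chord (h : R -> R) (a b s x t : R) :
  concave_on a b h -> a <= s -> s < x -> x < t -> t <= b ->
  (t - x) * h s + (x - s) * h t <= (t - s) * h x.
Proof.
  intros hh has hsx hxt htb.
  assert (hl : 0 <= (t - x) / (t - s) <= 1).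
  { split; [apply Rle_div_r | apply Rle_div_l]; lra. }
  assert (H := hh s t ((t - x) / (t - s)) ltac:(lra) ltac:(lra) hl).
  replace ((t - x) / (t - s) * s + (1 - (t - x) / (t - s)) * t) with x in H
    by (field; lra).
  apply (Rmult_le_compat_l (t - s)) in H; [ | lra].
  eapply Rle_trans; [ | exact H]; right; field; lra.
Qed.

(* If [h s > h t], compare [h] with the line through [(s, h s)] and [(t, h t)],
   which lies below [h] on [[s,t]] and above it on [[t,b]]. *)
Lemma concave_tail_growth (h : R -> R) (a b beta s t : R) :
  0 < beta -> (forall x, continuous h x) -> concave_on a b h ->
  (forall x, a < x < b -> 0 < h x) -> a < s -> s < t -> t < b ->
  Rpower (h s) (beta + 1) * RInt (fun x => ppow (h x) beta) t b
    <= Rpower (h t) (beta + 1) * RInt (fun x => ppow (h x) beta) s b.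
Proof.
  intros hbeta hc hh hpos has hst htb.
  set (f := fun x => ppow (h x) beta).
  assert (hf : forall x, continuous f x).
  { intros x; apply: continuous_ppow_comp => //. }
  assert (hfpos : forall x, a < x < b -> 0 < f x).
  { intros x hx; unfold f; rewrite ppow_pos_eq ?hpos //; [apply Rpower_pos | auto]. }
  assert (hsplit : RInt f s b = RInt f s t + RInt f t b).
  { symmetry; apply: RInt_Chasles; now apply: ex_RInt_continuous. }
  assert (hst0 : 0 < RInt f s t) by (apply RInt_gt_0 => // x hx; apply hfpos; lra).
  assert (htb0 : 0 < RInt f t b) by (apply RInt_gt_0 => // x hx; apply hfpos; lra).
  assert (hs : 0 < h s) by (apply hpos; lra).
  assert (ht : 0 < h t) by (apply hpos; lra).
  destruct (Rle_dec (h s) (h t)) as [hle | hlt].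
  { rewrite hsplit; apply Rmult_le_compat; try lra.
    - left; apply Rpower_pos.
    - apply Rle_Rpower_l; lra. }
  set (m := (h t - h s) / (t - s)).
  assert (hm : m < 0) by (apply Rlt_div_l; lra).
  set (l := fun x => h s + m * (x - s)).
  assert (hls : l s = h s) by (unfold l; ring).
  assert (hlt' : l t = h t) by (unfold l, m; field; lra).
  assert (hl1 : forall x, s < x < t -> 0 < l x <= h x).
  { intros x hx; split.
    - apply Rlt_trans with (h t) => //; rewrite -hlt' /l.
      assert (0 < - m * (t - x)) by (apply Rmult_lt_0_compat; lra); lra.
    - assert (H := concave_chord h a b s x t hh ltac:(lra) ltac:(lra) ltac:(lra) ltac:(lra)).
      apply (Rmult_le_reg_l (t - s)); [lra | ].
      eapply Rle_trans; [ | exact H]; right; unfold l, m; field; lra. }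
  assert (hl2 : forall x, t < x < b -> h x <= l x).
  { intros x hx.
    assert (H := concave_chord h a b s t x hh ltac:(lra) ltac:(lra) ltac:(lra) ltac:(lra)).
    apply (Rmult_le_reg_l (t - s)); [lra | ].
    apply Rle_trans with ((x - s) * h t - (x - t) * h s); [lra | ].
    right; unfold l, m; field; lra. }
  (* Chosen so that [P = - n l^(beta+1)] is an antiderivative of [l^beta] wherever [l > 0]. It is
     positive because [m < 0]. *)
  set (n := - / ((beta + 1) * m)).
  assert (hn : 0 < n).
  { unfold n; rewrite -Rinv_opp; apply Rinv_0_lt_compat.
    replace (- ((beta + 1) * m)) with ((beta + 1) * - m) by ring.
    apply Rmult_lt_0_compat; lra. }
  set (P := fun x => - n * ppow (l x) (beta + 1)).
  assert (hlc : forall x, continuous l x).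
  { intros x; apply: continuous_plus; [apply continuous_const | ].
    apply: continuous_mult; [apply continuous_const | ].
    apply: continuous_minus; [apply continuous_id | apply continuous_const]. }
  assert (hPc : forall x, continuous P x).
  { intros x; apply: continuous_mult; [apply continuous_const | ].
    apply: continuous_ppow_comp; [lra | apply hlc]. }
  assert (hPd : forall x, 0 < l x -> is_derive P x (ppow (l x) beta)).
  { intros x hx.
    assert (d1 : is_derive l x m) by (unfold l; auto_derive; [easy | ring]).
    assert (d2 := is_derive_scal _ x (- n) _ (is_derive_ppow_comp l x m (beta + 1) hx d1)).
    evar_last; [exact d2 | ].
    rewrite ppow_pos_eq //; replace (beta + 1 - 1) with beta by ring.
    unfold n; rewrite /= /mult /=; field; lra. }
  assert (hI1 : P t - P s <= RInt f s t).
  { apply (RInt_ge_increment f P (fun x => ppow (l x) beta)) => //.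
    - intros x hx; apply hPd, hl1; lra.
    - intros x hx; destruct (hl1 x hx); unfold f.
      rewrite !ppow_pos_eq; try lra; apply Rle_Rpower_l; lra. }
  assert (hI2 : RInt f t b <= P b - P t).
  { assert (H : - P b - - P t <= RInt (fun x => - f x) t b).
    { apply (RInt_ge_increment _ (fun x => - P x) (fun x => - ppow (l x) beta)) => //.
      - intros x; apply: continuous_opp; apply hf.
      - intros x; apply: continuous_opp; apply hPc.
      - intros x hx; apply: is_derive_opp; apply hPd.
        assert (h x <= l x) by now apply hl2.
        assert (0 < h x) by (apply hpos; lra); lra.
      - intros x hx.
        assert (h x <= l x) by now apply hl2.
        assert (0 < h x) by (apply hpos; lra).
        unfold f; rewrite !ppow_pos_eq; try lra.
        apply Ropp_le_contravar, Rle_Rpower_l; lra. }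
    rewrite (RInt_opp f) in H; [ | now apply: ex_RInt_continuous].
    rewrite /opp /= in H; lra. }
  assert (hPb : P b <= 0).
  { unfold P; assert (0 <= n * ppow (l b) (beta + 1)); [ | lra].
    apply Rmult_le_pos; [lra | apply ppow_ge0]. }
  unfold P in hI1, hI2; rewrite hls hlt' !(ppow_pos_eq (h _)) // in hI1.
  fold (P b) in hI2; rewrite hlt' (ppow_pos_eq (h _)) // in hI2.
  rewrite hsplit.
  assert (hXY : Rpower (h t) (beta + 1) < Rpower (h s) (beta + 1)).
  { apply Rlt_Rpower_l; lra. }
  assert (hY := Rpower_pos (h t) (beta + 1)).
  set (X := Rpower (h s) (beta + 1)) in *; set (Y := Rpower (h t) (beta + 1)) in *.
  (* With [I] and [T] the integrals of [f] over [[s,t]] and [[t,b]], this gives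
     [(X - Y) T <= n Y (X - Y) <= Y I], hence [X T <= Y (I + T)]. *)
  assert (h1 : Y * (n * (X - Y)) <= Y * RInt f s t) by (apply Rmult_le_compat_l; lra).
  assert (h2 : RInt f t b * (X - Y) <= n * Y * (X - Y)) by (apply Rmult_le_compat_r; lra).
  lra.
Qed.

(** * Power inequalities and the tail estimate for continuous [h] *)

Lemma Rpower_div_distr (x y z : R) :
  0 < x -> 0 < y -> Rpower (x / y) z = Rpower x z / Rpower y z.
Proof.
  intros hx hy; unfold Rdiv.
  rewrite -Rpower_mult_distr //; [ | now apply Rinv_0_lt_compat].
  f_equal; rewrite -Rpower_Ropp /Rpower ln_Rinv //; f_equal; ring.
Qed.

Lemma Rpower_root (x p : R) : 0 < x -> p <> 0 -> Rpower (Rpower x (1 / p)) p = x.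
Proof.
  intros hx hp; rewrite Rpower_mult; replace (1 / p * p) with 1 by (field; lra).
  now apply Rpower_1.
Qed.

Lemma Rle_Rpower_l_npos (x y z : R) :
  0 < x <= y -> z <= 0 -> Rpower y z <= Rpower x z.
Proof.
  intros hxy hz; rewrite -(Ropp_involutive z) !(Rpower_Ropp _ (- z)).
  apply Rinv_le_contravar; [apply Rpower_pos | apply Rle_Rpower_l; lra].
Qed.

Lemma Rpower_le_reg_l (x y z : R) :
  0 < z -> 0 < x -> 0 < y -> Rpower x z <= Rpower y z -> x <= y.
Proof.
  intros hz hx hy h; apply Rnot_lt_le => hlt; apply (Rle_not_lt _ _ h).
  now apply Rlt_Rpower_l.
Qed.

Lemma Rdiv_le_cross (p q r s : R) :
  0 < q -> 0 < s -> p * s <= r * q -> p / q <= r / s.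
Proof.
  intros hq hs h; apply Rle_div_l => //.
  replace (r / s * q) with (r * q / s) by (field; lra).
  now apply Rle_div_r.
Qed.

(** Both bounds come from [centroid_value_ge] applied to [G = F^(1/(beta+1))], with different
    factorizations of the weight [h^alpha]. Raising the result to the power [beta + 1] returns from
    [G] to [F]. *)
Lemma centroid_tail_ge (h : R -> R) (a b alpha beta : R) :
  a < b -> 0 < alpha -> 0 < beta ->
  (forall x, continuous h x) -> concave_on a b h -> 0 <= h a ->
  (forall x, a < x < b -> 0 < h x) ->
  let F x := RInt (fun t => ppow (h t) beta) x b in
  let g := RInt (fun t => t * ppow (h t) alpha) a b
             / RInt (fun t => ppow (h t) alpha) a b in
  (beta <= alpha -> Rpower ((beta + 1) / (alpha + 2)) (beta + 1) * F a <= F g) /\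
  (alpha <= beta -> Rpower ((alpha + 1) / (alpha + 2)) (beta + 1) * F a <= F g).
Proof.
  intros hab ha hb hc hh h0 hpos F g.
  set (f := fun x => ppow (h x) beta); set (w := fun x => ppow (h x) alpha).
  assert (hf : forall x, continuous f x) by (intros x; apply: continuous_ppow_comp => //).
  assert (hw : forall x, continuous w x) by (intros x; apply: continuous_ppow_comp => //).
  assert (hFpos : forall x, a <= x < b -> 0 < F x).
  { intros x hx; apply RInt_gt_0; [lra | | auto].
    intros y hy; rewrite ppow_pos_eq; [apply Rpower_pos | apply hpos; lra]. }
  assert (hFd : forall x, is_derive F x (- f x)).
  { intros x; now apply (is_derive_RInt_continuous' f). }
  set (r := 1 / (beta + 1)).
  assert (hr : 0 < r) by (apply Rdiv_lt_0_compat; lra).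
  set (G := fun x => ppow (F x) r).
  set (k := fun x => r * Rpower (h x / G x) beta).
  assert (hG : forall x, continuous G x).
  { intros x; apply: continuous_ppow_comp => //.
    apply: ex_derive_continuous; eexists; apply hFd. }
  assert (hGpos : forall x, a <= x < b -> 0 < G x).
  { intros x hx; unfold G; rewrite ppow_pos_eq; [apply Rpower_pos | now apply hFpos]. }
  assert (hGF : forall x, a <= x < b -> Rpower (G x) (beta + 1) = F x).
  { intros x hx; unfold G, r; rewrite ppow_pos_eq ?Rpower_root //; try lra; now apply hFpos. }
  assert (hGd : forall x, a < x < b -> is_derive G x (- k x)).
  { intros x hx; assert (hFx : 0 < F x) by (apply hFpos; lra).
    evar_last; [apply: is_derive_ppow_comp => // | ].
    assert (hhx := hpos x hx).
    unfold k, f, G; rewrite !ppow_pos_eq //.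
    rewrite Rpower_div_distr //; [ | apply Rpower_pos].
    (* Since [r - 1 = - r beta], the factor [F^(r-1)] of the derivative is [G^(-beta)]. *)
    rewrite Rpower_mult; replace (r * beta) with (- (r - 1)) by (unfold r; field; lra).
    rewrite Rpower_Ropp; field.
    apply Rgt_not_eq, Rpower_pos. }
  assert (hk : forall x, a < x < b -> 0 < k x).
  { intros x hx; apply Rmult_lt_0_compat => //; apply Rpower_pos. }
  assert (hratio : forall s t, a < s -> s < t -> t < b -> 0 < h s / G s <= h t / G t).
  { intros s t hs hst ht; split.
    - apply Rdiv_lt_0_compat; [apply hpos | apply hGpos]; lra.
    - assert (H := concave_tail_growth h a b beta s t hb hc hh hpos hs hst ht).
      apply Rdiv_le_cross; try (apply hGpos; lra).
      (* With [F = G^(beta+1)] the growth bound reads [(h s * G t)^(beta+1) <= (h t * G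
         s)^(beta+1)], and the power can be removed. *)
      fold (F s) (F t) in H; rewrite -(hGF s ltac:(lra)) -(hGF t ltac:(lra)) in H.
      assert (0 < h s) by (apply hpos; lra).
      assert (0 < h t) by (apply hpos; lra).
      assert (0 < G s) by (apply hGpos; lra).
      assert (0 < G t) by (apply hGpos; lra).
      rewrite !Rpower_mult_distr // in H.
      apply Rpower_le_reg_l in H => //; try lra; now apply Rmult_lt_0_compat. }
  assert (hkmono : forall s t, a < s -> s < t -> t < b -> k s <= k t).
  { intros s t hs hst ht; apply Rmult_le_compat_l; [lra | ].
    apply Rle_Rpower_l; [lra | now apply hratio]. }
  assert (hGb : G b = 0).
  { unfold G, F; rewrite RInt_point ppow_npos_eq //; apply Rle_refl. }
  assert (hdec := antitone_of_derive G k a b hG hGd hk).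
  assert (hg : a < g < b).
  { apply (centroid_between w) => //.
    intros x hx; unfold w; rewrite ppow_pos_eq; [apply Rpower_pos | now apply hpos]. }
  assert (hfinal : forall c, 0 < c -> c * G a <= G g -> Rpower c (beta + 1) * F a <= F g).
  { intros c hc0 H; rewrite -!hGF; try lra.
    assert (0 < G a) by (apply hGpos; lra).
    rewrite Rpower_mult_distr //; apply Rle_Rpower_l; [lra | ].
    split => //; now apply Rmult_lt_0_compat. }
  split; intros hle; (apply hfinal; [apply Rdiv_lt_0_compat; lra | ]).
  - set (v := fun x => G a - G x).
    assert (hv : forall x, a < x < b -> 0 < v x).
    { intros x hx; assert (G x < G a) by (apply hdec; lra); unfold v; lra. }
    replace (alpha + 2) with (beta + (alpha - beta) + 2) by ring.
    (* Here [h^alpha = (h/v)^(alpha-beta) v^(alpha-beta) G^beta (h/G)^beta], and the division by [r]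
       cancels the [r] in [k]. So [A = beta] and [B = alpha - beta]. *)
    apply (centroid_value_ge G k w (fun x => Rpower (h x / v x) (alpha - beta) / r)) => //;
      try lra.
    + intros x hx; apply Rdiv_lt_0_compat => //; apply Rpower_pos.
    + intros s t hs hst ht; apply Rmult_le_compat_r;
        [left; now apply Rinv_0_lt_compat | ].
      assert (hvs : 0 < v s) by (apply hv; lra).
      assert (hvt : 0 < v t) by (apply hv; lra).
      assert (hhs : 0 < h s) by (apply hpos; lra).
      assert (hht : 0 < h t) by (apply hpos; lra).
      apply Rle_Rpower_l; [lra | split; [now apply Rdiv_lt_0_compat | ]].
      (* Both [h] and [v] are compared with [x - a]. *)
      apply Rdiv_le_cross => //.
      assert (H1 := concave_chord h a b a s t hh ltac:(lra) hs hst ltac:(lra)).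
      assert (H1' : (s - a) * h t <= (t - a) * h s).
      { assert (0 <= (t - s) * h a) by (apply Rmult_le_pos; lra); lra. }
      (* The ratio [v x / (x - a)] is nondecreasing: the mean slope of [v] on [[a,s]] is
         [k xi <= k s], while the tangent of [G] at [s] makes the mean slope on [[s,t]] at least
         [k s]. *)
      assert (H2 := concave_tangent G k a b s t hG hGd hkmono ltac:(lra) ltac:(lra)).
      destruct (mean_value G (fun x => - k x) a s hs) as (xi & hxi & E) => //.
      { intros x hx; apply hGd; lra. }
      assert (hkxi : k xi <= k s) by (apply hkmono; lra).
      assert (H2' : (t - a) * v s <= (s - a) * v t).
      { unfold v.
        assert (H3 : k xi * (s - a) <= k s * (s - a)) by (apply Rmult_le_compat_r; lra).
        assert (H4 : (t - s) * (G a - G s) <= (t - s) * (k s * (s - a)))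
          by (apply Rmult_le_compat_l; lra).
        assert (H5 : (s - a) * (k s * (t - s)) <= (s - a) * (G s - G t))
          by (apply Rmult_le_compat_l; lra).
        lra. }
      apply (Rmult_le_reg_l (s - a)); [lra | ].
      apply Rle_trans with ((t - a) * h s * v s).
      * rewrite -Rmult_assoc; apply Rmult_le_compat_r; lra.
      * replace ((t - a) * h s * v s) with (h s * ((t - a) * v s)) by ring.
        replace ((s - a) * (h s * v t)) with (h s * ((s - a) * v t)) by ring.
        apply Rmult_le_compat_l; lra.
    + intros x hx; fold (v x); unfold w, k.
      assert (hvx := hv x hx); assert (hhx := hpos x hx).
      assert (hGx : 0 < G x) by (apply hGpos; lra).
      rewrite !Rpower_div_distr // ppow_pos_eq //.
      replace alpha with (beta + (alpha - beta)) at 1 by ring; rewrite Rpower_plus.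
      field; repeat split; apply Rgt_not_eq; try apply Rpower_pos; lra.
  - replace (alpha + 2) with (alpha + 0 + 2) by ring.
    (* Here [h^alpha = (h/G)^(alpha-beta) G^alpha (h/G)^beta], so [A = alpha] and [B = 0]. The
       exponent [alpha - beta] is nonpositive, so [phi] decreases as [h/G] grows. *)
    apply (centroid_value_ge G k w (fun x => Rpower (h x / G x) (alpha - beta) / r)) => //;
      try lra.
    + intros x hx; apply Rdiv_lt_0_compat => //; apply Rpower_pos.
    + intros s t hs hst ht; apply Rmult_le_compat_r;
        [left; now apply Rinv_0_lt_compat | ].
      apply Rle_Rpower_l_npos; [now apply hratio | lra].
    + intros x hx; unfold w, k.
      assert (hhx := hpos x hx).
      assert (hGx : 0 < G x) by (apply hGpos; lra).
      assert (G x < G a) by (apply hdec; lra).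
      rewrite !Rpower_div_distr // ppow_pos_eq // Rpower_O; [ | lra].
      replace (Rpower (h x) alpha) with (Rpower (h x) (beta + (alpha - beta)))
        by (f_equal; ring).
      replace (Rpower (G x) alpha) with (Rpower (G x) (beta + (alpha - beta)))
        by (f_equal; ring).
      rewrite !Rpower_plus.
      field; repeat split; apply Rgt_not_eq; try apply Rpower_pos; lra.
Qed.

(** * Continuous extension of a concave function *)

(** The limit is the infimum of [f] on the open interval, obtained as minus the supremum of
    [- f]. *)
Lemma monotone_limit_right (f : R -> R) (a b m : R) :
  a < b -> (forall x, a < x < b -> m <= f x) ->
  (forall s t, a < s -> s < t -> t < b -> f s <= f t) ->
  exists l : R, filterlim f (at_right a) (locally l).
Proof.
  intros hab hm hmono.
  destruct (completeness (fun y => exists x, a < x < b /\ y = - f x)) as (l & hub & hlub).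
  - exists (- m); intros y (x & hx & ->); specialize (hm x hx); lra.
  - exists (- f ((a + b) / 2)), ((a + b) / 2); split; [lra | easy].
  - assert (hl : forall x, a < x < b -> - l <= f x).
    { intros x hx; assert (- f x <= l) by (apply hub; now exists x); lra. }
    exists (- l); apply filterlim_locally => eps.
    destruct (classic (exists x, a < x < b /\ f x < - l + eps))
      as [(x & hx & hfx) | hno].
    + rewrite /at_right /within.
      apply: filter_imp (locally_lt x a (proj1 hx)) => y hy hay.
      assert (- l <= f y) by (apply hl; lra).
      assert (f y <= f x) by (apply hmono; lra).
      change (Rabs (f y - - l) < eps); apply Rabs_def1; lra.
    + assert (H : l <= l - eps); [ | pose proof (cond_pos eps); lra].
      apply hlub; intros y (x & hx & ->).
      apply Rnot_lt_le => hlt; apply hno; exists x; split; [easy | lra].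
Qed.

(* The slopes of the chords ending at [(b, h b)] are monotone and bounded near [a]. *)
Lemma concave_limit_right (h : R -> R) (a b : R) :
  a < b -> concave_on a b h ->
  exists l : R, filterlim h (at_right a) (locally l).
Proof.
  intros hab hh.
  set (tau := fun x => (h x - h b) / (b - x)).
  assert (htau : forall s t, a <= s -> s < t -> t < b -> tau s <= tau t).
  { intros s t hs hst ht; apply Rdiv_le_cross; try lra.
    assert (H := concave_chord h a b s t b hh hs hst ht ltac:(lra)); lra. }
  destruct (monotone_limit_right tau a b (tau a) hab) as (l & hl).
  - intros x hx; apply htau; lra.
  - intros s t hs; apply htau; lra.
  - exists (h b + l * (b - a)).
    apply (filterlim_ext_loc (fun x => h b + tau x * (b - x))).
    { rewrite /at_right /within.
      apply: filter_imp (locally_lt b a hab) => x hx _; unfold tau; field; lra. }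
    apply: (filterlim_comp_2 (H := locally (l * (b - a)))); last by apply: filterlim_plus.
    + apply filterlim_const.
    + apply: (filterlim_comp_2 (H := locally (b - a))); last by apply: filterlim_mult.
      * exact hl.
      * apply: (filterlim_filter_le_1 (F := locally a)); [apply filter_le_within | ].
        apply: (continuous_minus (fun _ => b) (fun x => x));
          [apply continuous_const | apply continuous_id].
Qed.

(** Reflection in the midpoint swaps the endpoints and so turns limits at [b] into limits at [a]. *)
Lemma concave_reflect (h : R -> R) (a b : R) :
  concave_on a b h -> concave_on a b (fun x => h (a + b - x)).
Proof.
  intros hh x y l hx hy hl.
  assert (H := hh (a + b - x) (a + b - y) l ltac:(lra) ltac:(lra) hl).
  eapply Rle_trans; [exact H | right; f_equal; ring].
Qed.

Lemma concave_limit_left (h : R -> R) (a b : R) :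
  a < b -> concave_on a b h ->
  exists l : R, filterlim h (at_left b) (locally l).
Proof.
  intros hab hh.
  destruct (concave_limit_right _ a b hab (concave_reflect h a b hh)) as (l & hl).
  exists l.
  apply (filterlim_ext (fun x => h (a + b - (a + b - x)))).
  { intros x; f_equal; ring. }
  apply (filterlim_comp _ _ _ (fun x => a + b - x) (fun x => h (a + b - x)) _ (at_right a));
    last exact hl.
  intros P (d & hd); exists d => y hy hyb; apply hd; [ | lra].
  change (Rabs (y - b) < d) in hy; change (Rabs (a + b - y - a) < d).
  rewrite -Rabs_Ropp; replace (- (a + b - y - a)) with (y - b) by ring; easy.
Qed.

(** Every chord through [(x, h x)] has slope between [q] and [p], the slopes of the chords from [x]
    to [b] and to [a]. This gives a Lipschitz bound at [x]; the summand 1 keeps [M] positive. *)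
Lemma concave_continuous_interior (h : R -> R) (a b x : R) :
  concave_on a b h -> a < x < b -> continuous h x.
Proof.
  intros hh hx.
  set (p := (h x - h a) / (x - a)); set (q := (h b - h x) / (b - x)).
  assert (hp : p * (x - a) = h x - h a) by (unfold p; field; lra).
  assert (hq : q * (b - x) = h b - h x) by (unfold q; field; lra).
  set (M := Rabs p + Rabs q + 1).
  assert (hM : 0 < M) by (unfold M; pose proof (Rabs_pos p); pose proof (Rabs_pos q); lra).
  assert (hpM : - M <= p <= M).
  { assert (H := Rabs_le_between p M); apply H; unfold M; pose proof (Rabs_pos q); lra. }
  assert (hqM : - M <= q <= M).
  { assert (H := Rabs_le_between q M); apply H; unfold M; pose proof (Rabs_pos p); lra. }
  assert (hlip : forall y, a < y < b -> Rabs (h y - h x) <= M * Rabs (y - x)).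
  { intros y hy; destruct (total_order_T y x) as [[h1 | ->] | h1].
    - assert (H1 := concave_chord h a b a y x hh ltac:(lra) ltac:(lra) h1 ltac:(lra)).
      assert (H2 := concave_chord h a b y x b hh ltac:(lra) h1 ltac:(lra) ltac:(lra)).
      assert (L1 : h x - h y <= p * (x - y)).
      { apply (Rmult_le_reg_l (x - a)); [lra | ].
        replace ((x - a) * (p * (x - y))) with (p * (x - a) * (x - y)) by ring.
        rewrite hp; lra. }
      assert (L2 : q * (x - y) <= h x - h y).
      { apply (Rmult_le_reg_l (b - x)); [lra | ].
        replace ((b - x) * (q * (x - y))) with (q * (b - x) * (x - y)) by ring.
        rewrite hq; lra. }
      assert (p * (x - y) <= M * (x - y)) by (apply Rmult_le_compat_r; lra).
      assert (- M * (x - y) <= q * (x - y)) by (apply Rmult_le_compat_r; lra).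
      rewrite (Rabs_left (y - x)); [ | lra]; apply Rabs_le; lra.
    - rewrite !Rminus_diag Rabs_R0; lra.
    - assert (H1 := concave_chord h a b a x y hh ltac:(lra) ltac:(lra) h1 ltac:(lra)).
      assert (H2 := concave_chord h a b x y b hh ltac:(lra) h1 ltac:(lra) ltac:(lra)).
      assert (L1 : h y - h x <= p * (y - x)).
      { apply (Rmult_le_reg_l (x - a)); [lra | ].
        replace ((x - a) * (p * (y - x))) with (p * (x - a) * (y - x)) by ring.
        rewrite hp; lra. }
      assert (L2 : q * (y - x) <= h y - h x).
      { apply (Rmult_le_reg_l (b - x)); [lra | ].
        replace ((b - x) * (q * (y - x))) with (q * (b - x) * (y - x)) by ring.
        rewrite hq; lra. }
      assert (p * (y - x) <= M * (y - x)) by (apply Rmult_le_compat_r; lra).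
      assert (- M * (y - x) <= q * (y - x)) by (apply Rmult_le_compat_r; lra).
      rewrite (Rabs_pos_eq (y - x)); [ | lra]; apply Rabs_le; lra. }
  apply filterlim_locally => eps.
  assert (he : 0 < eps / M) by (apply Rdiv_lt_0_compat; [apply cond_pos | easy]).
  apply: filter_imp (filter_and _ _ (locally_between a b x hx)
                       (locally_ball x (mkposreal _ he))) => y [hy hxy].
  change (Rabs (y - x) < eps / M) in hxy; change (Rabs (h y - h x) < eps).
  eapply Rle_lt_trans; [now apply hlip | ].
  apply Rlt_div_r in hxy => //; lra.
Qed.

(** Carries inequalities from the open interval to its endpoints, with [e] the amount by which
    points are moved inward. *)
Lemma nonneg_limit (f : R -> R) :
  continuous f 0 -> (forall e, 0 < e < 1 -> 0 <= f e) -> 0 <= f 0.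
Proof.
  intros hf hpos; apply Rnot_lt_le => hlt.
  assert (H := locally_lt 0 (f 0) hlt); apply hf in H; destruct H as (d & hd).
  set (e := Rmin (d / 2) (1 / 2)).
  assert (hd0 := cond_pos d).
  assert (he : 0 < e < 1 /\ e < d).
  { unfold e; pose proof (Rmin_l (d / 2) (1 / 2)); pose proof (Rmin_r (d / 2) (1 / 2)).
    assert (0 < Rmin (d / 2) (1 / 2)) by (apply Rmin_glb_lt; lra); lra. }
  assert (f e < 0).
  { apply hd; change (Rabs (e - 0) < d); rewrite Rminus_0_r Rabs_pos_eq; lra. }
  assert (0 <= f e) by (apply hpos; lra); lra.
Qed.

(** The endpoint values are replaced by the one-sided limits, which are also used as constants
    outside [[a,b]]. Concavity and nonnegativity pass from the interior to the closed interval by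
    continuity. *)
Lemma concave_continuous_extension (h : R -> R) (a b : R) :
  a < b -> concave_on a b h -> (forall x, a <= x <= b -> 0 <= h x) ->
  exists H : R -> R,
    (forall x, continuous H x) /\ (forall x, a < x < b -> H x = h x) /\
    concave_on a b H /\ (forall x, a <= x <= b -> 0 <= H x).
Proof.
  intros hab hh hnn.
  destruct (concave_limit_right h a b hab hh) as (la & hla).
  destruct (concave_limit_left h a b hab hh) as (lb & hlb).
  set (H := fun x => match Rle_dec x a with left _ => la | right _ =>
                     match Rle_dec b x with left _ => lb | right _ => h x end end).
  assert (Ha : forall x, x <= a -> H x = la).
  { intros x hx; unfold H; destruct (Rle_dec x a); [easy | lra]. }
  assert (Hb : forall x, b <= x -> H x = lb).
  { intros x hx; unfold H; destruct (Rle_dec x a); [lra | ].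
    destruct (Rle_dec b x); [easy | lra]. }
  assert (Hi : forall x, a < x < b -> H x = h x).
  { intros x hx; unfold H; destruct (Rle_dec x a); [lra | ].
    destruct (Rle_dec b x); [lra | easy]. }
  assert (Hc : forall x, continuous H x).
  { intros x; destruct (total_order_T x a) as [[hx | ->] | hx].
    - apply: (continuous_ext_loc _ (fun _ => la)); [ | apply continuous_const].
      apply: filter_imp (locally_lt a x hx) => y hy; rewrite Ha //; lra.
    - apply filterlim_locally => eps.
      assert (hr := proj1 (filterlim_locally h la) hla eps).
      apply: filter_imp (filter_and _ _ (locally_lt b a hab) hr) => y [hy1 hy2].
      rewrite (Ha a); [ | lra].
      destruct (Rle_dec y a) as [hya | hya].
      + rewrite Ha //; apply ball_center.
      + rewrite Hi; [apply hy2 | ]; lra.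
    - destruct (total_order_T x b) as [[hxb | ->] | hxb].
      + apply: (continuous_ext_loc _ h); [ | now apply (concave_continuous_interior h a b)].
        apply: filter_imp (locally_between a b x (conj hx hxb)) => y hy; now rewrite Hi.
      + apply filterlim_locally => eps.
        assert (hr := proj1 (filterlim_locally h lb) hlb eps).
        apply: filter_imp (filter_and _ _ (locally_gt a b hab) hr) => y [hy1 hy2].
        rewrite (Hb b); [ | lra].
        destruct (Rle_dec b y) as [hyb | hyb].
        * rewrite Hb //; apply ball_center.
        * rewrite Hi; [apply hy2 | ]; lra.
      + apply: (continuous_ext_loc _ (fun _ => lb)); [ | apply continuous_const].
        apply: filter_imp (locally_gt b x hxb) => y hy; rewrite Hb //; lra. }
  (* Points of [[a,b]] are pushed towards the midpoint [c], where [H = h]. *)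
  set (c := (a + b) / 2).
  set (push := fun x e => x + e * (c - x)).
  assert (hpush : forall x e, a <= x <= b -> 0 < e < 1 -> a < push x e < b).
  { intros x e hx he; unfold push.
    assert (h1 : 0 <= (1 - e) * (x - a)) by (apply Rmult_le_pos; lra).
    assert (h2 : 0 <= (1 - e) * (b - x)) by (apply Rmult_le_pos; lra).
    assert (h3 : 0 < e * (c - a)) by (apply Rmult_lt_0_compat; unfold c; lra).
    assert (h4 : 0 < e * (b - c)) by (apply Rmult_lt_0_compat; unfold c; lra).
    lra. }
  assert (hpush0 : forall x, push x 0 = x) by (intros x; unfold push; ring).
  assert (Hpc : forall x e, continuous (fun e => H (push x e)) e).
  { intros x e; apply: (continuous_comp (push x) H); [ | apply Hc].
    apply: ex_derive_continuous; unfold push; now auto_derive. }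
  exists H; split; [easy | split; [easy | split]].
  - intros x y l hx hy hl.
    set (z := l * x + (1 - l) * y).
    assert (hz : a <= z <= b).
    { unfold z.
      assert (0 <= l * (x - a)) by (apply Rmult_le_pos; lra).
      assert (0 <= (1 - l) * (y - a)) by (apply Rmult_le_pos; lra).
      assert (0 <= l * (b - x)) by (apply Rmult_le_pos; lra).
      assert (0 <= (1 - l) * (b - y)) by (apply Rmult_le_pos; lra).
      lra. }
    assert (E : 0 <= H (push z 0) - (l * H (push x 0) + (1 - l) * H (push y 0))).
    { apply (nonneg_limit (fun e => H (push z e) - (l * H (push x e) + (1 - l) * H (push y e)))).
      - apply: continuous_minus; [apply Hpc | ].
        apply: continuous_plus; (apply: continuous_mult; [apply continuous_const | apply Hpc]).
      - intros e he.
        assert (hpx := hpush x e hx he); assert (hpy := hpush y e hy he).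
        assert (hpz := hpush z e hz he).
        rewrite !Hi //.
        assert (K := hh (push x e) (push y e) l ltac:(lra) ltac:(lra) hl).
        (* For fixed [e] the map [push] is affine, so it commutes with convex combinations. *)
        replace (l * push x e + (1 - l) * push y e) with (push z e) in K
          by (unfold push, z; ring).
        lra. }
    rewrite !hpush0 in E; lra.
  - intros x hx; rewrite -(hpush0 x).
    apply (nonneg_limit (fun e => H (push x e))); [apply Hpc | ].
    intros e he; assert (hp := hpush x e hx he); rewrite Hi //; apply hnn; lra.
Qed.

(** * Interior positivity and the theorem *)

(** A point [x] other than [t] lies under the chord from [(t, h t)] to the endpoint beyond [x];
    there [h t > 0] has positive weight and the endpoint value is nonnegative. *)
Lemma concave_pos_interior (h : R -> R) (a b : R) :
  concave_on a b h -> (forall t, a <= t <= b -> 0 <= h t) ->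
  (exists t, a <= t <= b /\ h t <> 0) ->
  forall x, a < x < b -> 0 < h x.
Proof.
  intros hh hnn (t & ht & ht0) x hx.
  assert (hpos : 0 < h t) by (specialize (hnn t ht); lra).
  destruct (total_order_T t x) as [[h1 | <-] | h1] => //.
  - assert (H := concave_chord h a b t x b hh ltac:(lra) h1 ltac:(lra) ltac:(lra)).
    assert (0 <= h b) by (apply hnn; lra).
    assert (0 < (b - x) * h t) by (apply Rmult_lt_0_compat; lra).
    assert (0 <= (x - t) * h b) by (apply Rmult_le_pos; lra).
    apply (Rmult_lt_reg_l (b - t)); lra.
  - assert (H := concave_chord h a b a x t hh ltac:(lra) ltac:(lra) h1 ltac:(lra)).
    assert (0 <= h a) by (apply hnn; lra).
    assert (0 < (x - a) * h t) by (apply Rmult_lt_0_compat; lra).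
    assert (0 <= (t - x) * h a) by (apply Rmult_le_pos; lra).
    apply (Rmult_lt_reg_l (t - a)); lra.
Qed.

Theorem theorem1p2 (a b : R) (h : R -> R) (alpha beta : R)
  (hab : a < b)
  (hnonneg : forall t, a <= t <= b -> 0 <= h t)
  (hconc : concave_on a b h)
  (hnz : exists t, a <= t <= b /\ h t <> 0)
  (halpha : 0 < alpha) (hbeta : 0 < beta) :
  (beta <= alpha ->
     RInt (fun t => rpow (h t) beta) (g_alpha alpha a b h) b
       / RInt (fun t => rpow (h t) beta) a b
     >= Rpower ((beta + 1) / (alpha + 2)) (beta + 1)) /\
  (alpha <= beta ->
     RInt (fun t => rpow (h t) beta) (g_alpha alpha a b h) b
       / RInt (fun t => rpow (h t) beta) a b
     >= Rpower ((alpha + 1) / (alpha + 2)) (beta + 1)).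
Proof.
  assert (hpos := concave_pos_interior h a b hconc hnonneg hnz).
  (* The integrals see only the open interval, where [H = h > 0] and the two power functions agree,
     so everything can be computed with [H]. *)
  destruct (concave_continuous_extension h a b hab hconc hnonneg) as (H & Hc & Hi & Hh & Hnn).
  assert (Hpos : forall x, a < x < b -> 0 < H x) by (intros x hx; rewrite Hi //; now apply hpos).
  assert (Hw : forall y, 0 < y -> forall x, continuous (fun t => ppow (H t) y) x).
  { intros y hy x; apply: continuous_ppow_comp => //. }
  assert (Hwpos : forall y x, a < x < b -> 0 < ppow (H x) y).
  { intros y x hx; rewrite ppow_pos_eq; [apply Rpower_pos | now apply Hpos]. }
  assert (hE : forall y x, a < x < b -> rpow (h x) y = ppow (H x) y).
  { intros y x hx; rewrite Hi // rpow_ppow //; left; now apply hpos. }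
  assert (Eg : g_alpha alpha a b h = RInt (fun t => t * ppow (H t) alpha) a b
                                       / RInt (fun t => ppow (H t) alpha) a b).
  { unfold g_alpha; f_equal; apply RInt_ext => x;
      rewrite Rmin_left ?Rmax_right; try lra; intros hx; rewrite hE //. }
  (* The tail must start inside [[a,b)] for [H] to replace [h] in it. *)
  assert (hg : a < g_alpha alpha a b h < b).
  { rewrite Eg; apply centroid_between; auto. }
  assert (EF : forall x, a <= x < b ->
    RInt (fun t => rpow (h t) beta) x b = RInt (fun t => ppow (H t) beta) x b).
  { intros x hx; apply RInt_ext => y; rewrite Rmin_left ?Rmax_right; try lra.
    intros hy; apply hE; lra. }
  assert (hFa : 0 < RInt (fun t => ppow (H t) beta) a b) by (apply RInt_gt_0; auto).
  destruct (centroid_tail_ge H a b alpha beta hab halpha hbeta Hc Hh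
              (Hnn a ltac:(lra)) Hpos) as (h1 & h2).
  rewrite -Eg in h1 h2.
  rewrite !EF; try lra.
  split; intros hle; apply Rle_ge, Rle_div_r => //; auto.
Qed.
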